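(* Let $d\geq 1$ and let $X$ be a finite simplicial complex on vertex set $V$ of size $n$ with $h(X)=d$. Suppose that for some integer $k\geq -1$ the $k$-th spectral gap satisfies $\mu_k(X)=(d+1)(k+1)-dn$. Then $$X\cong \left(\Delta_d^{(d-1)}\right)^{*(n-k-1)}*\Delta_{(d+1)(k+1)-dn-1}.$$ In particular, $\dim(X)=k$.
   Context: An (abstract) simplicial complex $X$ on vertex set $V$ is a family of subsets of $V$ closed under taking subsets (so $\varnothing\in X$), with $V$ the union of its $0$-dimensional simplices. A simplex $\sigma$ has dimension $|\sigma|-1$; $X(k)$ is the set of $k$-dimensional simplices and $\dim(X)$ is the largest dimension of a simplex. A missing face of $X$ is a set $\sigma\subseteq V$ with $\sigma\notin X$ but every proper subset of $\sigma$ in $X$; $h(X)$ is the maximal dimension of a missing face of $X$. Fix a total order on $V$. For $k\geq 0$, $C^k(X)$ is the real vector space of real-valued skew-symmetric functions on ordered $k$-simplices (i.e. $\varphi(\sigma)=\mathrm{sgn}(\pi)\varphi(\tau)$ when $\sigma,\tau$ are the same set with orderings differing by permutation $\pi$), and $C^{-1}(X)=\mathbb{R}$. The coboundary $d_k:C^k(X)\to C^{k+1}(X)$ is $d_k\varphi(\sigma)=\sum_{i=0}^{k+1}(-1)^i\varphi(\sigma\setminus\{v_i\})$ for $\sigma=[v_0,\dots,v_{k+1}]$, and $d_{-1}a(v)=a$. With the inner product $\langle\varphi,\psi\rangle=\sum_{\sigma\in X(k)}\varphi(\sigma)\psi(\sigma)$ and adjoints $d_k^*$, the reduced $k$-dimensional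 Laplacian is $L_{-1}=d_{-1}^*d_{-1}$ and $L_k=d_{k-1}d_{k-1}^*+d_k^*d_k$ for $k\geq 0$. The $k$-th spectral gap $\mu_k(X)$ is the smallest eigenvalue of $L_k$. $\Delta_m$ denotes the complete simplicial complex (all subsets) on $m+1$ vertices ($\Delta_{-1}=\{\varnothing\}$), and $\Delta_m^{(j)}$ is its $j$-skeleton, consisting of all subsets of size at most $j+1$. The join of complexes $X,Y$ on disjoint vertex sets is $X*Y=\{\sigma\cup\tau:\sigma\in X,\tau\in Y\}$, and $X^{*s}$ is the join of $s$ disjoint copies of $X$. $X\cong Y$ means there is a bijection between vertex sets which together with its inverse maps simplices to simplices. *)

(* Defs.v *)
From HB Require Import structures.
From mathcomp Require Import all_boot all_order all_fingroup all_algebra.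
From mathcomp Require Import reals.

Set Implicit Arguments.
Unset Strict Implicit.
Unset Printing Implicit Defensive.

Import Order.TTheory GRing.Theory Num.Theory.

Local Open Scope ring_scope.

Record scomplex (V : finType) := SComplex {
  simplices :> {set {set V}};
  simplices_set0 : set0 \in simplices;
  simplices_sub : forall s t : {set V},
    t \subset s -> s \in simplices -> t \in simplices;
  simplices_vertex : forall v : V, [set v] \in simplices
}.

Section Invariants.
Context {V : finType}.
Implicit Types X : scomplex V.

Definition cdim X : int := (\max_(s in X : {set {set V}}) #|s|)%N%:Z - 1.

Definition missing_face X (s : {set V}) : bool :=
  (s \notin (X : {set {set V}})) &&
  [forall t : {set V}, (t \proper s) ==> (t \in (X : {set {set V}}))].

(* A missing face has at least two elements, so the predecessor is never
   truncated; the value is 0 when X has no missing face. *)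
Definition hdim X : nat := \max_(s | missing_face X s) #|s|.-1.

End Invariants.

Section Constructions.
Context {V W : finType}.

Definition isomorphic (K : {set {set V}}) (L : {set {set W}}) : Prop :=
  exists (f : V -> W) (g : W -> V),
    [/\ cancel f g, cancel g f,
        forall s : {set V}, s \in K -> f @: s \in L &
        forall t : {set W}, t \in L -> g @: t \in K].

Definition join (K : {set {set V}}) (L : {set {set W}}) : {set {set (V + W)%type}} :=
  [set inl @: (s : {set V}) :|: inr @: (t : {set W}) | s in K, t in L].

(* The join of s copies of K, the i-th copy living on the vertices (i, _);
   for s = 0 it is the complex whose only simplex is empty. *)
Definition join_power (K : {set {set V}}) (s : nat) : {set {set 'I_s * V}} :=
  [set \bigcup_(i < s) [set (i, v) | v in (f : {ffun 'I_s -> {set V}}) i]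
     | f in ffun_on (mem K)].

Definition skeleton (K : {set {set V}}) (j : nat) : {set {set V}} :=
  [set s in K | (#|s| <= j.+1)%N].

End Constructions.

(* The complete complex on p vertices, that is, Delta_(p - 1). *)
Definition complete (p : nat) : {set {set 'I_p}} := [set: {set 'I_p}].

(* Throughout, cochains are indexed by the number m of vertices of a simplex,
   so that degree k corresponds to m = k + 1 and the degree -1 is m = 0. *)
Section Cochains.
Context {V : finType}.
Implicit Types X : scomplex V.

Definition osimplex X (m : nat) :=
  {t : m.-tuple V | uniq t && ([set x in t] \in (X : {set {set V}}))}.

Section OrderedSimplices.
Variables (X : scomplex V) (m : nat).

Fact face_subproof (t : osimplex X m.+1) (i : 'I_m.+1) :
  let u := [tuple tnth (val t) (lift i j) | j < m] in
  uniq u && ([set x in u] \in (X : {set {set V}})).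
Proof.
case: t => t /= /andP[Ut Xt]; apply/andP; split.
  rewrite map_inj_uniq ?enum_uniq // => j1 j2 /tuple_uniqP-/(_ Ut).
  exact: lift_inj.
apply: simplices_sub Xt; apply/subsetP=> x; rewrite !inE.
by case/mapP=> j _ ->; apply: mem_tnth.
Qed.

Definition face (t : osimplex X m.+1) (i : 'I_m.+1) : osimplex X m :=
  Sub [tuple tnth (val t) (lift i j) | j < m] (face_subproof t i).

Fact reorder_subproof (t : osimplex X m) (p : 'S_m) :
  let u := [tuple tnth (val t) (p j) | j < m] in
  uniq u && ([set x in u] \in (X : {set {set V}})).
Proof.
case: t => t /= /andP[Ut Xt]; apply/andP; split.
  rewrite map_inj_uniq ?enum_uniq // => j1 j2 /tuple_uniqP-/(_ Ut).
  exact: perm_inj.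
apply: simplices_sub Xt; apply/subsetP=> x; rewrite !inE.
by case/mapP=> j _ ->; apply: mem_tnth.
Qed.

Definition reorder (t : osimplex X m) (p : 'S_m) : osimplex X m :=
  Sub [tuple tnth (val t) (p j) | j < m] (reorder_subproof t p).

(* The total order on V is that of its enumeration; it only selects the
   representatives in the inner product below, which does not depend on it
   for skew-symmetric functions. *)
Definition increasing (t : osimplex X m) : bool :=
  sorted ltn [seq nat_of_ord (enum_rank x) | x <- val t].

Lemma tnth_reorder (t : osimplex X m) (p : 'S_m) (j : 'I_m) :
  tnth (val (reorder t p)) j = tnth (val t) (p j).
Proof. by rewrite tnth_mktuple. Qed.

Lemma tnth_face (t : osimplex X m.+1) (i : 'I_m.+1) (j : 'I_m) :
  tnth (val (face t i)) j = tnth (val t) (lift i j).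
Proof. by rewrite tnth_mktuple. Qed.

Lemma tnth_osimplex_inj (t : osimplex X m) : injective (tnth (val t)).
Proof. by case: t => t /= /andP[/tuple_uniqP]. Qed.

Lemma osimplexP (t u : osimplex X m) :
  tnth (val t) =1 tnth (val u) -> t = u.
Proof. by move=> e; apply/val_inj/eq_from_tnth. Qed.

Lemma reorderM (t : osimplex X m) (p q : 'S_m) :
  reorder (reorder t p) q = reorder t (q * p)%g.
Proof. by apply: osimplexP => j; rewrite !tnth_reorder permM. Qed.

Lemma reorder1 (t : osimplex X m) : reorder t 1%g = t.
Proof. by apply: osimplexP => j; rewrite tnth_reorder perm1. Qed.

Lemma reorder_inj (t : osimplex X m) : injective (reorder t).
Proof.
move=> p q e; apply/permP=> j; apply: (@tnth_osimplex_inj t).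
by rewrite -!tnth_reorder e.
Qed.

Lemma reorder_perm_eq (t u : osimplex X m) :
  perm_eq (val t) (val u) -> exists p : 'S_m, t = reorder u p.
Proof.
by case/tuple_permP=> p e; exists p; apply/val_inj/val_inj.
Qed.

Lemma perm_eq_reorder (t : osimplex X m) (p : 'S_m) :
  perm_eq (val (reorder t p)) (val t).
Proof. by apply/tuple_permP; exists p. Qed.

Lemma increasing_perm_eq (t u : osimplex X m) :
  increasing t -> increasing u -> perm_eq (val t) (val u) -> t = u.
Proof.
move=> it iu e; apply/val_inj/val_inj.
have f_inj : injective (fun x : V => nat_of_ord (enum_rank x)).
  by move=> x y /val_inj/enum_rank_inj.
apply: (inj_map f_inj); apply: (irr_sorted_eq ltn_trans ltnn it iu).
by apply: perm_mem; rewrite perm_map.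
Qed.

Lemma increasing_ex (t : osimplex X m) :
  exists (u : osimplex X m) (p : 'S_m), increasing u /\ t = reorder u p.
Proof.
pose f x := nat_of_ord (enum_rank (x : V)).
have f_inj : injective f by move=> x y /val_inj/enum_rank_inj.
pose s := sort (relpre f leq) (val t).
have es : perm_eq s (val t) by rewrite perm_sort.
have sz : size s == m by rewrite (perm_size es) size_tuple.
have /andP[Ut Xt] := valP t.
have Us : uniq (Tuple sz) && ([set x in Tuple sz] \in (X : {set {set V}})).
  rewrite (perm_uniq es) Ut /= (_ : [set x in _] = [set x in val t]) //.
  by apply/setP=> x; rewrite !inE -(perm_mem es).
have [p e] : exists p, t = reorder (Sub (Tuple sz) Us : osimplex X m) p.
  by apply: reorder_perm_eq; rewrite perm_sym.
exists (Sub (Tuple sz) Us), p; split=> //.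
rewrite /increasing /= ltn_sorted_uniq_leq map_inj_uniq // (perm_uniq es) Ut.
by rewrite sorted_map; apply: sort_sorted => x y /=; apply: leq_total.
Qed.

End OrderedSimplices.

Lemma face_reorder X m (t : osimplex X m.+1) (i j : 'I_m.+1) (q : 'S_m) :
  face (reorder t (lift_perm i j q)) i = reorder (face t j) q.
Proof.
apply: osimplexP => l.
by rewrite tnth_face !tnth_reorder tnth_face lift_perm_lift.
Qed.

Section SkewSymmetric.
Variables (R : realType) (X : scomplex V) (m : nat).

Definition skew : {pred {ffun osimplex X m -> R^o}} :=
  fun f => [forall t, forall p : 'S_m, f (reorder t p) == (-1) ^+ p * f t].

Lemma skewP (f : {ffun osimplex X m -> R^o}) :
  reflect (forall t (p : 'S_m), f (reorder t p) = (-1) ^+ p * f t) (f \in skew).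
Proof.
by apply: (iffP 'forall_'forall_eqP).
Qed.

Fact skew_submod_closed : submod_closed skew.
Proof.
split=> [|a f g /skewP sf /skewP sg]; apply/skewP=> t p; rewrite !ffunE ?mulr0 //.
by rewrite sf sg mulrDr mulrCA.
Qed.

HB.instance Definition _ :=
  GRing.isSubmodClosed.Build R {ffun osimplex X m -> R^o} skew skew_submod_closed.

Record cochain := Cochain {
  cochain_val :> {ffun osimplex X m -> R^o};
  _ : cochain_val \in skew
}.

HB.instance Definition _ := [isSub for cochain_val].
HB.instance Definition _ := [Choice of cochain by <:].
HB.instance Definition _ := [SubChoice_isSubLmodule of cochain by <:].

Lemma cochain_reorder (f : cochain) t (p : 'S_m) :
  f (reorder t p) = (-1) ^+ p * f t.
Proof. exact: skewP (valP f) t p. Qed.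

Definition inner (f g : cochain) : R :=
  \sum_(t : osimplex X m | increasing t) f t * g t.

(* The cochain equal to the sign of p at the reordering of t by p and to 0 at
   every other simplex; when t ranges over the increasing ordered simplices
   these form an orthonormal basis. *)
Fact elementary_subproof (t : osimplex X m) :
  [ffun u : osimplex X m =>
     \sum_(p : 'S_m | u == reorder t p) (-1) ^+ p : R^o] \in skew.
Proof.
apply/skewP=> u q; rewrite !ffunE mulr_sumr.
rewrite (reindex_inj (mulgI q)) /=; apply: eq_big => p.
  rewrite -reorderM; apply/eqP/eqP=> [|-> //].
  move=> /(congr1 (fun v => reorder v q^-1%g)).
  by rewrite !reorderM ?mulgA mulVg mul1g reorder1.
by move=> _; rewrite odd_permM signr_addb.
Qed.

Definition elementary (t : osimplex X m) : cochain :=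
  Cochain (elementary_subproof t).

Lemma elementary_reorder (t u : osimplex X m) (q : 'S_m) :
  elementary (reorder t q) u = (-1) ^+ q * elementary t u.
Proof.
rewrite !ffunE mulr_sumr (reindex_inj (mulIg q^-1%g)) /=; apply: eq_big => p.
  by rewrite reorderM mulgKV.
by move=> _; rewrite odd_permM odd_permV signr_addb mulrC.
Qed.

Lemma cochain_elementary (f : cochain) (u : osimplex X m) :
  f u = \sum_(t | increasing t) f t * elementary t u.
Proof.
have [t0 [p0 [inc0 ->]]] := increasing_ex u.
rewrite (bigD1 t0) //= big1 ?addr0 => [|t /andP[inct nt]].
  rewrite ffunE (bigD1 p0) //= big1 ?addr0 => [|p /andP[/eqP/reorder_inj-> /eqP//]].
  by rewrite cochain_reorder mulrC.
rewrite ffunE big1 ?mulr0 // => p /eqP e; case/eqP: nt.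
apply: increasing_perm_eq => //.
by rewrite -(permPl (perm_eq_reorder t p)) -e perm_eq_reorder.
Qed.

End SkewSymmetric.

Arguments skew {R X m}.
Arguments elementary R {X m} t.

Section Operators.
Variables (R : realType) (X : scomplex V) (m : nat).

Fact coboundary_subproof (f : cochain R X m) :
  [ffun t : osimplex X m.+1 =>
     \sum_(i < m.+1) (-1) ^+ i * f (face t i) : R^o] \in skew.
Proof.
apply/skewP=> t p; rewrite !ffunE mulr_sumr [RHS](reindex_inj (@perm_inj _ p)) /=.
apply: eq_bigr => i _.
have [q ->] : exists q, p = lift_perm i (p i) q.
  have q_ex (j : 'I_m) : {k | p (lift i j) = lift (p i) k}.
    case: (unliftP (p i) (p (lift i j))) => [k ->|/perm_inj e]; first by exists k.
    by have := neq_lift i j; rewrite e eqxx.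
  have q_inj : injective (fun j => sval (q_ex j)).
    move=> j1 j2 e; apply/(@lift_inj _ i)/(@perm_inj _ p).
    by rewrite (svalP (q_ex j1)) (svalP (q_ex j2)) e.
  exists (perm q_inj); apply/permP=> j.
  case: (unliftP i j) => [j' ->|->]; last by rewrite lift_perm_id.
  by rewrite lift_perm_lift permE; apply: svalP (q_ex j').
rewrite face_reorder cochain_reorder lift_perm_id odd_lift_perm !mulrA.
congr (_ * _); rewrite !signr_addb !signr_odd.
by rewrite mulrAC -[in RHS](mulrA (_ ^+ i)) -expr2 sqrr_sign mulr1.
Qed.

Definition coboundary (f : cochain R X m) : cochain R X m.+1 :=
  Cochain (coboundary_subproof f).

(* The value at t of the adjoint applied to g is its inner product with the
   elementary cochain of t, that is <d (elementary t), g>; the adjunction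
   identity is inner_coboundary_adj. *)
Fact coboundary_adj_subproof (g : cochain R X m.+1) :
  [ffun t : osimplex X m => inner (coboundary (elementary R t)) g : R^o] \in skew.
Proof.
apply/skewP=> t p; rewrite !ffunE /inner mulr_sumr; apply: eq_bigr => u _.
rewrite mulrA; congr (_ * _); rewrite !ffunE mulr_sumr; apply: eq_bigr => i _.
by rewrite mulrCA elementary_reorder.
Qed.

Definition coboundary_adj (g : cochain R X m.+1) : cochain R X m :=
  Cochain (coboundary_adj_subproof g).

Theorem inner_coboundary_adj (f : cochain R X m) (g : cochain R X m.+1) :
  inner (coboundary f) g = inner f (coboundary_adj g).
Proof.
rewrite /inner; under [RHS]eq_bigr do rewrite ffunE /inner mulr_sumr.
rewrite exchange_big /=; apply: eq_bigr => u _.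
under eq_bigr do rewrite mulrA.
rewrite -mulr_suml; congr (_ * _); rewrite !ffunE.
under [RHS]eq_bigr do rewrite ffunE mulr_sumr.
rewrite exchange_big /=; apply: eq_bigr => i _.
rewrite [in LHS]cochain_elementary mulr_sumr.
by apply: eq_bigr => t _; rewrite mulrCA.
Qed.

End Operators.

Definition laplacian (R : realType) X (m : nat) : cochain R X m -> cochain R X m :=
  match m with
  | 0 => fun f => coboundary_adj (coboundary f)
  | m'.+1 => fun f =>
      coboundary (coboundary_adj f) + coboundary_adj (coboundary f)
  end.

Definition laplacian_eigenvalue (R : realType) X (m : nat) (a : R) : Prop :=
  exists2 f : cochain R X m, f != 0 & laplacian f = a *: f.

(* Meaningful for -1 <= k only. No mu satisfies this when X has no simplex of
   dimension k, as the cochain space is then 0. *)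
Definition is_spectral_gap (R : realType) X (k : int) (mu : R) : Prop :=
  let m := absz (k + 1) in
  laplacian_eigenvalue X m mu /\
  forall a : R, laplacian_eigenvalue X m a -> mu <= a.

End Cochains.

(* Main.v *)
Require Import Defs.
From HB Require Import structures.
From mathcomp Require Import all_boot all_order all_fingroup all_algebra.
From mathcomp Require Import reals ring.

Set Implicit Arguments.
Unset Strict Implicit.
Unset Printing Implicit Defensive.

Import Order.TTheory GRing.Theory Num.Theory.

Local Open Scope ring_scope.

(* Let f be an eigencochain and t a simplex at which |f| is maximal. If a
   vertex v outside t is not in the link of t, then t + v contains a missing face, which has at most
   d + 1 vertices, so at most d vertices of t can be exchanged for v inside X;
   this gives the lower bound (d + 1)(k + 1) - dn of Gershgorin's theorem. When
   it is attained, t is a facet, every v outside t lies in a unique missing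
   face T v of t + v, it has d + 1 vertices, and exchanging v with any other
   vertex of T v reverses the sign of f, hence keeps |f| maximal. The signs
   force the T v to be pairwise disjoint, and iterated exchanges show that X
   contains the complement of every transversal of the T v. Hence X consists of
   the sets containing no T v. *)

(** * Exchange of one vertex of an ordered simplex *)

Section Replace.
Variables (V : finType) (m : nat).
Implicit Types (t : m.-tuple V) (i j : 'I_m) (v w : V).

Definition replace (t : m.-tuple V) (i : 'I_m) (v : V) : m.-tuple V :=
  [tuple if j == i then v else tnth t j | j < m].

Lemma tnth_replace t i v j :
  tnth (replace t i v) j = if j == i then v else tnth t j.
Proof. by rewrite tnth_mktuple. Qed.

Lemma replace_id t i : replace t i (tnth t i) = t.
Proof. by apply: eq_from_tnth => j; rewrite tnth_replace; case: eqP => // ->. Qed.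

Lemma replace_replace t i v w : replace (replace t i v) i w = replace t i w.
Proof. by apply: eq_from_tnth => j; rewrite !tnth_replace; case: eqP. Qed.

Lemma set_replace t i v : uniq t ->
  [set x in replace t i v] = v |: ([set x in t] :\ tnth t i).
Proof.
move=> /tuple_uniqP t_inj; apply/setP=> x; rewrite !inE.
apply/tnthP/orP => [[j ->]|].
  rewrite tnth_replace; have [_|ji] := eqVneq j i; first by left.
  by right; rewrite mem_tnth andbT (inj_eq t_inj).
case=> [/eqP->|/andP[xi /tnthP[j ej]]].
  by exists i; rewrite tnth_replace eqxx.
exists j; rewrite tnth_replace; have [e|_] := eqVneq j i; last by rewrite ej.
by rewrite ej e eqxx in xi.
Qed.

End Replace.

(** * A pointwise formula for the Laplacian *)

Section Extension.
Variables (V : finType) (R : realType) (X : scomplex V).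

(** Exchanging a vertex may leave [X] or repeat an entry. Extending by 0 lets the sums below run
    over all vertices and positions without side conditions. *)
Definition ext m (f : cochain R X m) (t : m.-tuple V) : R :=
  if insub t is Some u then f u else 0.

Section Basics.
Variable m : nat.
Implicit Types (f : cochain R X m) (u : osimplex X m) (t : m.-tuple V).

Lemma ext_val f u : ext f (val u) = f u.
Proof. by rewrite /ext valK. Qed.

Lemma ext_neq0 f t :
  ext f t != 0 -> exists2 u : osimplex X m, val u = t & ext f t = f u.
Proof. by rewrite /ext; case: insubP => [u _ <- _|_]; [exists u | rewrite eqxx]. Qed.

Lemma ext_not f t : ~~ uniq t -> ext f t = 0.
Proof. by rewrite /ext; case: insubP => [u /andP[->]|]. Qed.

Lemma ext_reorder f t (p : 'S_m) :
  ext f [tuple tnth t (p j) | j < m] = (-1) ^+ p * ext f t.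
Proof.
rewrite {2}/ext; case: insubP => [u _ <-|nt].
  by rewrite -(cochain_reorder f u p) -ext_val.
rewrite mulr0; apply/eqP/negPn/negP=> /ext_neq0[u eu _].
case/negP: nt; suff <- : val (reorder u p^-1%g) = t by exact: (valP (reorder u _)).
by apply: eq_from_tnth => j; rewrite tnth_reorder eu tnth_mktuple permKV.
Qed.

Lemma ext_elementary u t :
  ext (elementary R u) t = \sum_(q : 'S_m | t == val (reorder u q)) (-1) ^+ q.
Proof.
rewrite /ext; case: insubP => [w _ <-|nt]; first by rewrite ffunE.
rewrite big1 // => q /eqP e; case/negP: nt; rewrite e; exact: (valP (reorder u q)).
Qed.

Lemma ext_sum f t :
  ext f t = \sum_(u | increasing u) f u * ext (elementary R u) t.
Proof.
rewrite /ext; case: insubP => [w _ _|nt]; first exact: cochain_elementary.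
by rewrite big1 // => u _; rewrite mulr0.
Qed.

End Basics.

(** The two tuples differ by the cycle that moves [v] from the front to position [i], whose sign is
    (-1)^i. *)
Lemma ext_cons m (f : cochain R X m.+1) (t : m.+1.-tuple V)
    (i : 'I_m.+1) v :
  ext f [tuple of v :: [tuple tnth t (lift i j) | j < m]]
  = (-1) ^+ i * ext f (replace t i v).
Proof.
rewrite -[(-1) ^+ i](_ : (-1) ^+ lift_perm ord0 i (1 : 'S_m) = _); last first.
  by rewrite odd_lift_perm odd_perm1 addbF /= signr_odd.
rewrite -ext_reorder; congr ext; apply: eq_from_tnth => j; rewrite tnth_mktuple.
case: (unliftP ord0 j) => [j' ->|->].
  rewrite lift_perm_lift perm1 tnth_replace [_ == i]eq_sym (negPf (neq_lift i j')).
  by rewrite tnthS tnth_mktuple.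
by rewrite lift_perm_id tnth_replace eqxx tnth0.
Qed.

Lemma sum_lift_perm m (F : 'S_m.+1 -> R) :
  \sum_q F q = \sum_i \sum_(p : 'S_m) F (lift_perm ord0 i p).
Proof.
rewrite pair_bigA /= (reindex (fun ip : 'I_m.+1 * 'S_m => lift_perm ord0 ip.1 ip.2)) //.
apply: onW_bij; apply: inj_card_bij.
  move=> [i p] [j q] /= e.
  have eij : i = j by rewrite -(lift_perm_id ord0 i p) e lift_perm_id.
  subst j; congr (_, _); apply/permP => j; apply: (@lift_inj _ i).
  by rewrite -(lift_perm_lift ord0 i p) -(lift_perm_lift ord0 i q) e.
by rewrite card_prod card_ord !card_Sn factS.
Qed.

(** After expanding [g] in elementary cochains, compare coefficients: a permutation of [u] giving
    [v :: t] amounts to a choice of the position of [v] in [u] together with a reordering of the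
    opposite face. This is the splitting in [sum_lift_perm]. *)
Lemma coboundary_adjE m (g : cochain R X m.+1) (t : osimplex X m) :
  coboundary_adj g t = \sum_v ext g [tuple of v :: val t].
Proof.
rewrite ffunE /inner; under [RHS]eq_bigr do rewrite ext_sum.
rewrite exchange_big /=; apply: eq_bigr => u _; rewrite -mulr_sumr mulrC.
congr (_ * _); under [RHS]eq_bigr do rewrite ext_elementary big_mkcond.
rewrite exchange_big sum_lift_perm ffunE; apply: eq_bigr => i _.
rewrite ffunE mulr_sumr (reindex_inj invg_inj) /= [LHS]big_mkcond.
apply: eq_bigr => p _; rewrite -big_mkcond /=.
rewrite odd_lift_perm odd_permV /= signr_addb signr_odd.
have -> : (face u i == reorder t p^-1) = (val t == val (reorder (face u i) p)).
  rewrite val_eqE; apply/eqP/eqP => [->|->].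
    by rewrite reorderM mulgV reorder1.
  by rewrite reorderM mulVg reorder1.
rewrite -(face_reorder u ord0 i p); set w := reorder u _.
(* At most one [v] contributes, namely the first entry of [w]. *)
have wE v : ([tuple of v :: val t] == val w)
  = (v == tnth (val w) ord0) && (val t == val (face w ord0)).
  apply/eqP/andP => [e|[/eqP-> /eqP e]].
    rewrite -e tnth0; split=> //; apply/eqP/eq_from_tnth => j.
    by rewrite tnth_face -e tnthS.
  apply: eq_from_tnth => j; case: (unliftP ord0 j) => [j' ->|->].
    by rewrite tnthS e tnth_face.
  by rewrite tnth0.
under eq_bigl do rewrite wE.
case: eqP => _; last by rewrite big1 // => v; rewrite andbF.
by under eq_bigl do rewrite andbT; rewrite big_pred1_eq.
Qed.

(** Deleting [v] gives [f t]; deleting another vertex gives, by [ext_cons], an exchange of that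
    vertex for [v], and the signs combine to -1. *)
Lemma ext_coboundary_cons m (f : cochain R X m) (t : osimplex X m) v :
  ext (coboundary f) [tuple of v :: val t]
  = if (v \notin val t) && (v |: [set x in val t] \in (X : {set {set V}}))
    then f t - \sum_i ext f (replace (val t) i v) else 0.
Proof.
have setE : [set x in [tuple of v :: val t]] = v |: [set x in val t].
  by apply/setP=> x; rewrite !inE.
have Ut : uniq (val t) by have /andP[] := valP t.
rewrite {1}/ext; case: insubP => [w|]; last first.
  by rewrite setE /= Ut andbT => /negPf->.
rewrite setE /= Ut andbT => -> ew; rewrite ffunE big_ord_recl mul1r.
congr (_ + _).
  congr (f _); apply: osimplexP => j; rewrite tnth_face [val w]ew tnthS //.
rewrite -sumrN; case: m f t w ew {setE Ut} => [|m] f t w ew; first by rewrite !big_ord0.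
apply: eq_bigr => i _; rewrite exprS mulN1r mulNr; congr (- _).
rewrite -[RHS](signrMK i) -ext_cons -ext_val.
congr (_ * ext _ _); apply: eq_from_tnth => j; rewrite tnth_face [val w]ew.
case: (unliftP ord0 j) => [j' ->|->]; rewrite ?tnth0 ?tnthS ?tnth_mktuple.
  (* Deleting position i+1 of [v :: t] keeps [v] in front and deletes position i of [t]. *)
  have -> : lift (lift ord0 i) (lift ord0 j') = lift ord0 (lift i j').
    by apply: ord_inj; rewrite /= /bump /= !add1n ltnS addnS.
  by rewrite tnthS.
have -> : lift (lift ord0 i) ord0 = ord0 :> 'I_m.+2 by apply: val_inj.
by rewrite tnth0.
Qed.

(** The down part of the Laplacian contributes all exchanges. For [v] outside [t] with [v |: t] in
    [X], the up part cancels them and leaves [f t]. For [v] in [t] the up part vanishes, and only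
    the exchange of [v] for itself survives. *)
Lemma laplacianE m (f : cochain R X m) (t : osimplex X m) :
  laplacian f t =
    \sum_v if v |: [set x in val t] \in (X : {set {set V}}) then f t
           else \sum_i ext f (replace (val t) i v).
Proof.
have /andP[Ut Xt] := valP t.
have -> : laplacian f t = coboundary_adj (coboundary f) t
  + \sum_v \sum_i ext f (replace (val t) i v).
  case: m f t {Ut Xt} => [|m] f t.
    by rewrite big1 ?addr0 // => v _; rewrite big_ord0.
  rewrite /laplacian /= ffunE addrC; congr (_ + _).
  rewrite ffunE exchange_big /=; apply: eq_bigr => i _.
  rewrite coboundary_adjE mulr_sumr; apply: eq_bigr => v _.
  by rewrite /face /= ext_cons signrMK.
rewrite coboundary_adjE -big_split /=; apply: eq_bigr => v _.
rewrite ext_coboundary_cons; have [vt|_] /= := boolP (v \in val t); last first.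
  by case: ifP => _; rewrite ?subrK ?add0r.
rewrite (setUidPr _) ?Xt ?sub1set ?inE // add0r.
have /tnthP[i0 ei0] := vt; rewrite (bigD1 i0) //= big1.
  by rewrite addr0 ei0 replace_id ext_val.
move=> i ii0; apply: ext_not; apply/negP=> /tuple_uniqP/(_ i i0).
rewrite !tnth_replace eqxx eq_sym (negPf ii0) ei0 => /(_ erefl) e.
by rewrite e eqxx in ii0.
Qed.

End Extension.

(** * Missing faces and their size *)

Section MissingFaces.
Variables (V : finType) (X : scomplex V).
Implicit Types (s T : {set V}).

Lemma missing_face_notin T : missing_face X T -> T \notin (X : {set {set V}}).
Proof. by case/andP. Qed.

Lemma missing_face_ex s : s \notin (X : {set {set V}}) ->
  exists2 T, missing_face X T & T \subset s.
Proof.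
move=> sX; have [T minT Ts] :=
  @minset_exists V (fun T => T \notin (X : {set {set V}})) s sX.
exists T => //; have [TX Tmin] := minsetP minT.
rewrite /missing_face TX; apply/forall_inP=> T' ltT'.
apply/negPn/negP=> /Tmin-/(_ (proper_sub ltT')) eT'.
by rewrite eT' properxx in ltT'.
Qed.

Lemma card_missing_face T : missing_face X T -> (#|T| <= (hdim X).+1)%N.
Proof.
move=> mT; rewrite -(prednK (n := #|T|)) ?ltnS.
  exact: (@leq_bigmax_cond _ _ (fun s : {set V} => #|s|.-1) _ mT).
(* The predecessor in [hdim] is not truncated, since the empty set is a simplex. *)
rewrite card_gt0; apply: contraNneq (missing_face_notin mT) => ->.
exact: simplices_set0.
Qed.

End MissingFaces.

(** * The equality case of the Gershgorin estimate *)

(* [slack v] is the contribution of the vertex [v] to the Gershgorin estimate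
   of the row of [t], multiplied by [f t] to make it nonnegative; the
   contributions sum to 0, so each of them vanishes. *)
Section Extremal.
Variables (R : realType) (V : finType) (X : scomplex V) (d m : nat).
Variables (f : cochain R X m) (t : osimplex X m).
Hypothesis leXd : (hdim X <= d)%N.
Hypothesis eig : laplacian f = ((d.+1 * m)%:R - (d * #|V|)%:R) *: f.
Hypothesis fmax : forall u, `|f u| <= `|f t|.

Let S := [set x in val t].
Let term v : R :=
  if v |: S \in (X : {set {set V}}) then f t
  else \sum_i ext f (replace (val t) i v).
Let slack v : R := (term v + d%:R * f t - (v \in val t)%:R * d.+1%:R * f t) * f t.

Let SX : S \in (X : {set {set V}}).
Proof. by have /andP[] := valP t. Qed.

Let Ut : uniq (val t).
Proof. by have /andP[] := valP t. Qed.

(** The [term v] sum to the Laplacian at [t], which is ((d+1)m - dn) f(t). The two corrections sum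
    to dn f(t) and -(d+1)m f(t), which cancel it. *)
Lemma sum_slack : \sum_v slack v = 0.
Proof.
rewrite -mulr_suml; apply/eqP; rewrite mulf_eq0; apply/orP; left.
rewrite sumrB big_split /= -laplacianE sumr_const -!mulr_suml -natr_sum.
have -> : (\sum_v (v \in val t))%N = m.
  rewrite -[RHS](size_tuple (val t)) -(card_uniqP Ut) -sum1_card [RHS]big_mkcond.
  by apply: eq_bigr => v _; case: (v \in _).
have -> : laplacian f t = ((d.+1 * m)%:R - (d * #|V|)%:R) * f t by rewrite eig ffunE.
rewrite mulrBl -mulrnAl -mulrnA -natrM [#|_|](_ : _ = #|V|) //.
by rewrite [(m * _)%N]mulnC subrK subrr.
Qed.

Let pos (T : {set V}) := [set i | tnth (val t) i \in T].

Lemma card_pos v T : missing_face X T -> T \subset v |: S -> v \in T ->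
  v \notin val t -> #|pos T|.+1 = #|T|.
Proof.
move=> mT sT vT vt; rewrite (cardsD1 v T) vT; congr (_.+1).
have <- : tnth (val t) @: pos T = T :\ v.
  apply/setP=> x; rewrite !inE; apply/imsetP/andP => [[i]|[xv xT]].
    rewrite inE => iT ->; split=> //.
    by apply: contraNneq vt => <-; exact: mem_tnth.
  have := subsetP sT x xT; rewrite !inE (negPf xv) => /tnthP[i ei].
  by exists i; rewrite ?inE -?ei.
by rewrite card_imset //; exact: tnth_osimplex_inj.
Qed.

Lemma mem_missing_face v T : missing_face X T -> T \subset v |: S -> v \in T.
Proof.
move=> mT sT; apply: contraR (missing_face_notin mT) => vT.
apply: simplices_sub SX; apply/subsetP=> x xT.
have := subsetP sT x xT; rewrite !inE => /orP[/eqP exv|//].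
by rewrite -exv xT in vT.
Qed.

(** An exchange at a position outside [T] leaves all of [T] in the new set, so this set is not a
    simplex and [ext] vanishes. The quantity d f(t)^2 is then distributed over the positions in [T],
    the surplus forming the first summand. *)
Lemma slackE v T : missing_face X T -> T \subset v |: S -> v \notin val t ->
  slack v = (d - #|pos T|)%:R * f t ^+ 2
    + \sum_(i in pos T) (f t ^+ 2 + ext f (replace (val t) i v) * f t).
Proof.
move=> mT sT vt.
have vX : v |: S \notin (X : {set {set V}}).
  by apply: contra (missing_face_notin mT); apply: simplices_sub.
(* This keeps [d - #|pos T|] from being truncated. *)
have lepos : (#|pos T| <= d)%N.
  rewrite -ltnS (card_pos mT sT) ?(mem_missing_face mT) //.
  by apply: leq_trans (card_missing_face mT) _.
rewrite /slack /term (negPf vX) (negPf vt) !mul0r subr0 big_split /=.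
rewrite sumr_const natrB // mulrBl -[_ *+ #|_|]mulr_natl addrA subrK.
rewrite mulrDl addrC expr2 mulrA mulr_suml; congr (_ + _).
rewrite [LHS](bigID (mem (pos T))) /= [X in _ + X]big1 ?addr0 // => i.
rewrite inE => iT; apply/eqP; rewrite mulf_eq0; apply/orP; left.
apply/negPn/negP=> /ext_neq0[u eu _]; case/negP: (missing_face_notin mT).
have /andP[_] := valP u; apply: simplices_sub; rewrite eu set_replace //.
apply/subsetP=> x xT; have := subsetP sT x xT; rewrite !inE.
by case: eqP => //= _ ->; rewrite andbT; apply: contraNneq iT => <-.
Qed.

Lemma ext_mul_ge0 s : 0 <= f t ^+ 2 + ext f s * f t.
Proof.
have : `|ext f s * f t| <= f t ^+ 2.
  rewrite -real_normK ?num_real // normrM expr2 ler_wpM2r //.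
  have [->|/ext_neq0[u _ ->] //] := eqVneq (ext f s) 0; by rewrite normr0.
by rewrite ler_norml -subr_ge0 opprK addrC => /andP[].
Qed.

Lemma slackE_simplex v : v |: S \in (X : {set {set V}}) -> v \notin val t ->
  slack v = d.+1%:R * f t ^+ 2.
Proof.
move=> vX vt; rewrite /slack /term vX (negPf vt) !mul0r subr0.
by rewrite expr2 mulrA; congr (_ * _); rewrite -natr1 mulrDl mul1r addrC.
Qed.

Lemma slack_eq0 v : slack v = 0.
Proof.
suff slack_ge0 w : true -> 0 <= slack w by apply: (psumr_eq0P slack_ge0 sum_slack).
move=> _; have [wt|wt] := boolP (w \in val t).
  have wS : w |: S = S by apply/setUidPr; rewrite sub1set inE.
  have -> : slack w = (f t + d%:R * f t - d.+1%:R * f t) * f t.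
    by rewrite /slack /term wS SX wt mul1r.
  by rewrite -natr1 [(_ + 1) * _]mulrDl mul1r [_ + f t]addrC subrr mul0r.
have [wX|/missing_face_ex[T mT sT]] := boolP (w |: S \in (X : {set {set V}})).
  by rewrite slackE_simplex // mulr_ge0 ?sqr_ge0.
rewrite (slackE mT sT wt) (addr_ge0 (mulr_ge0 (ler0n _ _) (sqr_ge0 _))) //.
by apply: sumr_ge0 => i _; exact: ext_mul_ge0.
Qed.

Hypothesis ft_neq0 : f t != 0.

Lemma extremal_notin v : v \notin val t -> v |: S \notin (X : {set {set V}}).
Proof.
move=> vt; apply/negP=> vX; have := slack_eq0 v; rewrite slackE_simplex // => /eqP.
by rewrite mulf_eq0 pnatr_eq0 sqrf_eq0 (negPf ft_neq0).
Qed.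

(** Both summands of [slackE] are nonnegative, hence zero. The first forces [T] to have d positions
    in [t], the second forces every exchange inside [T] to reverse the sign of [f]. *)
Lemma extremal_missing v T : missing_face X T -> T \subset v |: S ->
    v \notin val t ->
  #|T| = d.+1 /\
  forall i, tnth (val t) i \in T -> ext f (replace (val t) i v) = - f t.
Proof.
move=> mT sT vt; have /eqP := slack_eq0 v; rewrite (slackE mT sT vt).
have posT := card_pos mT sT (mem_missing_face mT sT) vt.
rewrite paddr_eq0 ?(mulr_ge0 (ler0n _ _) (sqr_ge0 _)) //; last first.
  by apply: sumr_ge0 => i _; exact: ext_mul_ge0.
rewrite mulf_eq0 pnatr_eq0 sqrf_eq0 (negPf ft_neq0) orbF subn_eq0.
case/andP=> led /eqP sum0; split.
  apply/eqP; rewrite -posT eqSS eqn_leq led andbT -ltnS posT.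
  exact: leq_trans (card_missing_face mT) _.
move=> i iT; have := @psumr_eq0P _ _ _ _ (fun j _ => ext_mul_ge0 (replace (val t) j v)) sum0 i.
rewrite inE => /(_ iT)/eqP; rewrite expr2 -mulrDl mulf_eq0 (negPf ft_neq0) orbF.
by rewrite addrC addr_eq0 => /eqP.
Qed.

End Extremal.

(** * Exchanges among maximal simplices and the missing faces of [X] *)

Section Rigidity.
Variables (R : realType) (V : finType) (X : scomplex V) (d m : nat).
Variables (f : cochain R X m) (t : osimplex X m).
Hypothesis leXd : (hdim X <= d)%N.
Hypothesis eig : laplacian f = ((d.+1 * m)%:R - (d * #|V|)%:R) *: f.
Hypothesis fmax : forall u, `|f u| <= `|f t|.
Hypothesis ft_neq0 : f t != 0.

Implicit Types (u : osimplex X m) (T : {set V}) (v w : V).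

(** An exchange inside a missing face preserves this property, so the extremal lemmas can be applied
    again with the new simplex in place of [t]. *)
Let maximal u := `|f u| = `|f t|.
Let supp u : {set V} := [set x in val u].

Let maximal_le u : maximal u -> forall u', `|f u'| <= `|f u|.
Proof. by move=> ->. Qed.

Let maximal_neq0 u : maximal u -> f u != 0.
Proof. by move=> mu; rewrite -normr_eq0 mu normr_eq0. Qed.

Lemma maximal_missing_ex u v : maximal u -> v \notin supp u ->
  exists2 T, missing_face X T & T \subset v |: supp u.
Proof.
move=> mu vu; apply: missing_face_ex.
apply: (extremal_notin leXd eig (maximal_le mu) (maximal_neq0 mu)).
by rewrite inE in vu.
Qed.

Lemma maximal_missing_card u v T : maximal u -> v \notin supp u ->
  missing_face X T -> T \subset v |: supp u -> #|T| = d.+1.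
Proof.
move=> mu vu mT sT; rewrite inE in vu.
by have [] := extremal_missing leXd eig (maximal_le mu) (maximal_neq0 mu) mT sT vu.
Qed.

Lemma maximal_replace u v T x : maximal u -> v \notin supp u ->
    missing_face X T -> T \subset v |: supp u -> x \in T -> x != v ->
  exists i u', [/\ tnth (val u) i = x, val u' = replace (val u) i v,
    supp u' = v |: (supp u :\ x) & f u' = - f u].
Proof.
move=> mu vu mT sT xT xv; have := subsetP sT x xT.
rewrite !inE (negPf xv) => /tnthP[i ei]; rewrite inE in vu.
have [_ /(_ i)] := extremal_missing leXd eig (maximal_le mu) (maximal_neq0 mu) mT sT vu.
rewrite -ei => /(_ xT) efi; have : ext f (replace (val u) i v) != 0.
  by rewrite efi oppr_eq0 maximal_neq0.
case/ext_neq0 => u' eu' fu'; exists i, u'; split=> //; last by rewrite -fu'.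
by rewrite /supp eu' set_replace ?ei //; have /andP[] := valP u.
Qed.

(** If x were in [T] but not in [T'], exchanging x for [v] would give a simplex containing [T'].
    Since the cardinalities agree, one inclusion suffices. *)
Lemma maximal_missing_unique u v T T' : maximal u -> v \notin supp u ->
    missing_face X T -> T \subset v |: supp u ->
    missing_face X T' -> T' \subset v |: supp u ->
  T = T'.
Proof.
move=> mu vu mT sT mT' sT'; apply/eqP; rewrite eqEcard.
rewrite (maximal_missing_card mu vu mT sT) (maximal_missing_card mu vu mT' sT') leqnn.
rewrite andbT; apply/subsetP=> x xT; apply/negPn/negP=> xT'.
have xv : x != v by apply: contraNneq xT' => ->; exact: (mem_missing_face mT' sT').
have [i [u' [_ _ su' _]]] := maximal_replace mu vu mT sT xT xv.
case/negP: (missing_face_notin mT'); have /andP[_] := valP u'.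
apply: simplices_sub; rewrite -/(supp u') su'; apply/subsetP=> y yT'.
have := subsetP sT' y yT'; rewrite !inE; case: eqP => //= _ ->; rewrite andbT.
by apply: contraNneq xT' => <-.
Qed.

(* If [x] lay in both missing faces, then replacing [x] by [v], replacing [x]
   by [w], and replacing [v] by [w] would each reverse the sign of [f]. *)
Lemma maximal_missing_disjoint u v w T T' : maximal u ->
    v \notin supp u -> w \notin supp u -> v != w ->
    missing_face X T -> T \subset v |: supp u ->
    missing_face X T' -> T' \subset w |: supp u ->
  [disjoint T & T'].
Proof.
move=> mu vu wu vw mT sT mT' sT'; apply/pred0P=> x /=; apply/negbTE/negP.
case/andP=> xT xT'.
have xv : x != v.
  apply: contraTneq xT' => ->; apply/negP=> /(subsetP sT').
  by rewrite in_setU1 (negPf vw) (negPf vu).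
have xw : x != w.
  apply: contraTneq xT => ->; apply/negP=> /(subsetP sT).
  by rewrite in_setU1 eq_sym (negPf vw) (negPf wu).
have [i [u1 [ei eu1 su1 fu1]]] := maximal_replace mu vu mT sT xT xv.
have [j [u2 [ej eu2 _ fu2]]] := maximal_replace mu wu mT' sT' xT' xw.
have eij : j = i by apply: (@tnth_osimplex_inj _ _ _ u); rewrite ei ej.
rewrite {}eij {j ej} in eu2.
have mu1 : maximal u1 by rewrite /maximal fu1 normrN.
have wu1 : w \notin supp u1.
  by rewrite su1 !inE eq_sym (negPf vw) -[w \in val u]in_set (negPf wu) andbF.
have [T'' mT'' sT''] := maximal_missing_ex mu1 wu1.
have [vT''|vT''] := boolP (v \in T'').
  have [i' [u3 [ei' eu3 _ fu3]]] := maximal_replace mu1 wu1 mT'' sT'' vT'' vw.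
  have eii : i' = i.
    apply: (@tnth_osimplex_inj _ _ _ u1); rewrite ei' [val u1]eu1.
    by rewrite tnth_replace eqxx.
  have eu : u3 = u2 by apply: val_inj; rewrite eu3 eii eu1 replace_replace eu2.
  have := maximal_neq0 mu; move: fu3; rewrite eu fu2 fu1 opprK => /eqP.
  by rewrite eq_sym -subr_eq0 opprK -mulr2n mulrn_eq0 /= => ->.
(* If [v] is not in [T''], then [T''] already lies in [w |: supp u], so it is [T'] and contains x;
   but x has been removed from [u1]. *)
have eT : T'' = T'.
  apply: (maximal_missing_unique mu wu) => //; apply/subsetP=> y yT''.
  have := subsetP sT'' y yT''; rewrite su1 !inE.
  case: eqP => //= _; case: eqP => [e|_ /andP[]//].
  by rewrite -e yT'' in vT''.
have := subsetP sT'' x; rewrite eT su1 => /(_ xT').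
by rewrite !inE (negPf xw) (negPf xv) eqxx.
Qed.

(** [A] is the complement of [t], and [T v] is the missing face that [v] creates when added to
    [t]. *)
Theorem maximal_structure : exists (A : {set V}) (T : V -> {set V}),
  [/\ (#|A| + m)%N = #|V|,
      forall v, v \in A -> v \in T v /\ #|T v| = d.+1,
      forall v w, v \in A -> w \in A -> v != w -> [disjoint T v & T w] &
      forall s, (s \in (X : {set {set V}})) = [forall v in A, ~~ (T v \subset s)]].
Proof.
pose A := ~: supp t; have mt : maximal t by [].
(* The default [set0] can occur only for [v] outside [A]. *)
pose T v := odflt set0 [pick T | missing_face X T && (T \subset v |: supp t)].
have TP v : v \in A -> missing_face X (T v) /\ T v \subset v |: supp t.
  rewrite in_setC => vt; rewrite /T; case: pickP => [T' /andP[]//|noT].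
  have [T' mT' sT'] := maximal_missing_ex mt vt.
  by have := noT T'; rewrite mT' sT'.
have vT v : v \in A -> v \in T v.
  by move=> /TP[mT sT]; apply: mem_missing_face mT sT.
have dT v w : v \in A -> w \in A -> v != w -> [disjoint T v & T w].
  move=> vA wA vw; have [mv sv] := TP v vA; have [mw sw] := TP w wA.
  by rewrite !in_setC in vA wA; apply: (maximal_missing_disjoint mt vA wA vw).
have inT v w x : v \in A -> w \in A -> x \in T v -> x \in T w -> v = w.
  move=> vA wA xv xw; apply/eqP/negPn/negP=> /(dT v w vA wA)/pred0P/(_ x).
  by rewrite /= xv xw.
(* Here [c] chooses a transversal, and within [A] it moves only points of [D]. Induction on the size
   of [D] replaces [v] by [c v] in the complement, one exchange at a time starting from [t]. *)
have transversal (n : nat) : forall (D : {set V}) (c : V -> V), #|D| = n ->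
    (forall v, v \in A -> c v \in T v) ->
    (forall v, v \in A -> v \notin D -> c v = v) ->
  exists2 u, maximal u & supp u = ~: (c @: A).
  elim: n => [|n IHn] D c cardD cT cD.
    exists t => //; rewrite -[LHS]setCK; congr (~: _); rewrite -/A.
    rewrite (eq_in_imset (g := id)) ?imset_id // => v vA.
    by apply: cD => //; rewrite (cards0_eq cardD) inE.
  have /card_gt0P[v vD] : (0 < #|D|)%N by rewrite cardD.
  pose c' x := if x == v then v else c x.
  have [| | |u mu su] := IHn (D :\ v) c'.
  - by move: cardD; rewrite (cardsD1 v) vD => -[].
  - by move=> w wA; rewrite /c'; case: eqP => [<-|_]; [apply: vT | apply: cT].
  - move=> w wA; rewrite !inE negb_and negbK /c'.
    by case: eqP => [->//|_ /=]; apply: cD.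
  have c'E w : w \in A -> w != v -> c' w = c w by rewrite /c' => _ /negPf->.
  have [vA|vA] := boolP (v \in A); last first.
    exists u => //; rewrite su; congr (~: _); apply: eq_in_imset => w wA.
    by apply: c'E => //; apply: contraNneq vA => <-.
  have [cv|cv] := eqVneq (c v) v.
    exists u => //; rewrite su; congr (~: _); apply: eq_in_imset => w wA.
    by rewrite /c'; case: eqP => [->|].
  have c'v : c' v = v by rewrite /c' eqxx.
  have vu : v \notin supp u by rewrite su inE negbK -{1}c'v imset_f.
  have c'T w : w \in A -> c' w \in T w.
    by move=> wA; rewrite /c'; case: eqP => [->|_]; [apply: vT | apply: cT].
  (* For w != v, the vertex [c' w] absent from [u] lies in [T w], which is disjoint from [T v].
     Hence [T v] is still a missing face of [v |: supp u]. *)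
  have sTu : T v \subset v |: supp u.
    apply/subsetP=> x xT; rewrite su !inE; case: eqP => //= /eqP xv.
    apply/imsetP=> -[w wA ex]; have e : v = w.
      by apply: (inT v w x) => //; rewrite ex c'T.
    by rewrite ex -e c'v eqxx in xv.
  have [i [u' [_ _ su' fu']]] := maximal_replace mu vu (TP v vA).1 sTu (cT v vA) cv.
  exists u'; first by rewrite /maximal fu' normrN.
  rewrite su' su; apply/setP=> x; rewrite !inE.
  have [->|xv] /= := eqVneq x v.
    apply/esym/imsetP=> -[w wA ev]; have e : v = w.
      by apply: (inT v w v) => //; rewrite ?vT // {1}ev cT.
    by rewrite -e in ev; rewrite -ev eqxx in cv.
  rewrite -negb_or; congr (~~ _); apply/orP/imsetP => [[/eqP->|/imsetP[w wA ex]]|].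
  - by exists v.
  - have wv : w != v by apply: contraNneq xv => e; rewrite ex e c'v.
    by exists w; rewrite // ex c'E.
  case=> w wA ->; have [->|wv] := eqVneq w v; first by left.
  by right; apply/imsetP; exists w; rewrite ?c'E.
exists A, T; split.
- have /andP[Ut _] := valP t.
  by rewrite addnC -(cardsC (supp t)); congr (_ + _)%N; rewrite cardsE (card_uniqP Ut) size_tuple.
- move=> v vA; split; first exact: vT.
  have [mT sT] := TP v vA; apply: (maximal_missing_card mt _ mT sT).
  by rewrite in_setC in vA.
- exact: dT.
move=> s; apply/idP/forall_inP=> [sX v /TP[mT _]|noT].
  by apply: contra (missing_face_notin mT) => /simplices_sub; apply.
(* Conversely, if [s] contains no [T v], a point of each [T v] outside [s] gives a transversal whose
   complement contains [s]. *)
have cP v : exists x, (v \in A) ==> (x \in T v :\: s).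
  have [/noT/subsetPn[x xT xs]|_] := boolP (v \in A); last by exists v.
  by exists x; rewrite inE xs.
pose c v := xchoose (cP v).
have cT v : v \in A -> c v \in T v :\: s by move=> vA; exact: (implyP (xchooseP (cP v))).
have [| |u _ su] := transversal #|A| A c erefl.
- by move=> v /cT/setDP[].
- by move=> v ->.
have /andP[_] := valP u; apply: simplices_sub; rewrite -/(supp u) su.
apply/subsetP=> x xs; rewrite inE; apply/imsetP=> -[v vA ex].
by have /setDP[_] := cT v vA; rewrite -ex xs.
Qed.

End Rigidity.

(** * Complexes with pairwise disjoint missing faces, as joins *)

Section DisjointMissingFaces.
Local Open Scope nat_scope.

(** A subset of a block of d+1 vertices has at most d elements exactly when it misses a vertex;
    [0 < d] makes the skeleton bound [d.-1.+1] equal to d. *)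
Lemma mem_join_skeleton d s p (t : {set 'I_s * 'I_d.+1 + 'I_p}) : 0 < d ->
  (t \in join (join_power (skeleton (complete d.+1) d.-1) s) (complete p))
  = [forall i, exists j, inl (i, j) \notin t].
Proof.
move=> d0; have inl_inj : injective (@inl ('I_s * 'I_d.+1) 'I_p) by move=> ? ? [].
have mem_bigcup (F : {ffun 'I_s -> {set 'I_d.+1}}) i j :
    ((i, j) \in \bigcup_(k < s) [set (k, v) | v in F k]) = (j \in F i).
  apply/bigcupP/idP => [[k _ /imsetP[v vF [-> ->]]]//|jF].
  by exists i => //; apply: imset_f.
apply/imset2P/'forall_existsP => [[a b /imsetP[F /ffun_onP FK ->] _ ->] i|tP].
  have := FK i; rewrite !inE prednK //= => cardF.
  have /subsetPn[j _ jF] : ~~ ([set: 'I_d.+1] \subset F i).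
    by apply: contraL cardF => /subset_leq_card; rewrite cardsT card_ord -ltnNge.
  exists j; rewrite inE mem_imset // mem_bigcup (negPf jF) /=.
  by apply/imsetP=> -[].
pose F := [ffun i => [set j | inl (i, j) \in t]].
exists (\bigcup_(k < s) [set (k, v) | v in F k]) [set j | inr j \in t].
- apply: imset_f; apply/ffun_onP=> i; rewrite !inE prednK //= ffunE.
  have [j jt] := tP i; rewrite -ltnS -[in ltnRHS](card_ord d.+1) -cardsT.
  by apply: proper_card; rewrite properT; apply/eqP=> /setP/(_ j); rewrite !inE (negPf jt).
- by rewrite inE.
apply/setP=> -[[i j]|j]; rewrite inE.
  rewrite mem_imset // mem_bigcup ffunE inE orb_idr // => /imsetP[]//.
rewrite orb_idl; last by case/imsetP.
by rewrite mem_imset ?inE // => ? ? [].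
Qed.

Variables (V : finType) (K : {set {set V}}) (d : nat).
Variables (A : {set V}) (T : V -> {set V}).
Hypothesis memT : forall v, v \in A -> v \in T v.
Hypothesis cardT : forall v, v \in A -> #|T v| = d.+1.
Hypothesis disjT :
  forall v w, v \in A -> w \in A -> v != w -> [disjoint T v & T w].
Hypothesis memK : forall s, (s \in K) = [forall v in A, ~~ (T v \subset s)].

Lemma disjoint_family_inj v w x :
  v \in A -> w \in A -> x \in T v -> x \in T w -> v = w.
Proof.
move=> vA wA xv xw; apply/eqP/negPn/negP=> /(disjT vA wA)/pred0P/(_ x).
by rewrite /= xv xw.
Qed.

(** A simplex misses a vertex of every [T v], and these vertices are distinct by disjointness. The
    complement of [A] attains the bound. *)
Lemma max_card_simplex : \max_(s in K) #|s| = #|V| - #|A|.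
Proof.
apply/eqP; rewrite eqn_leq; apply/andP; split.
  apply/bigmax_leqP=> s; rewrite memK => /forall_inP noT.
  have cP v : exists x, (v \in A) ==> (x \in T v :\: s).
    have [/noT/subsetPn[x xT xs]|_] := boolP (v \in A); last by exists v.
    by exists x; rewrite inE xs.
  pose c v := xchoose (cP v).
  have cT v : v \in A -> c v \in T v :\: s.
    by move=> vA; exact: (implyP (xchooseP (cP v))).
  have c_inj : {in A &, injective c}.
    move=> v w vA wA e; have /setDP[cv _] := cT v vA; have /setDP[cw _] := cT w wA.
    by apply: (disjoint_family_inj (x := c v)) => //; rewrite e.
  rewrite -(card_in_imset c_inj) -(cardsC (c @: A)) addKn; apply: subset_leq_card.
  apply/subsetP=> x xs; rewrite inE; apply/imsetP=> -[v vA ex].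
  by have /setDP[_] := cT v vA; rewrite -ex xs.
rewrite -(cardsC A) addKn; apply: (@leq_bigmax_cond _ _ (fun s : {set V} => #|s|)).
rewrite memK; apply/forall_inP=> v vA.
by apply/subsetPn; exists v; rewrite ?memT // inE negbK.
Qed.

Let p := #|~: \bigcup_(v in A) T v|.

(** The block with index i enumerates the i-th missing face; the remaining [p] vertices lie in no
    missing face and form the simplex factor. The default of [nth] is never reached, as each face
    has d+1 vertices. *)
Let g (w : 'I_#|A| * 'I_d.+1 + 'I_p) : V :=
  match w with
  | inl (i, j) => nth (enum_val i) (enum (T (enum_val i))) j
  | inr k => enum_val k
  end.

Let g_inl i j : g (inl (i, j)) \in T (enum_val i).
Proof. by rewrite -mem_enum mem_nth // -cardE cardT ?enum_valP. Qed.

Let g_inlP v x : v \in A -> x \in T v -> exists i j, enum_val i = v /\ g (inl (i, j)) = x.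
Proof.
move=> vA xT; exists (enum_rank_in vA v).
have lt_j : index x (enum (T v)) < d.+1 by rewrite -(cardT vA) cardE index_mem mem_enum.
by exists (Ordinal lt_j); rewrite /= enum_rankK_in // nth_index // mem_enum.
Qed.

Let g_inr k v : v \in A -> g (inr k) \notin T v.
Proof.
move=> vA; have := enum_valP k; rewrite inE; apply: contra => kT.
by apply/bigcupP; exists v.
Qed.

Let g_inj : injective g.
Proof.
case=> [[i j]|k] [[i' j']|k'] e.
- have ei : i = i'.
    apply: enum_val_inj; apply: (disjoint_family_inj (x := g (inl (i, j)))).
    + exact: enum_valP.
    + exact: enum_valP.
    + exact: g_inl.
    + by rewrite e; exact: g_inl.
  subst i'; congr (inl (_, _)); apply: ord_inj; apply/eqP.
  move: e => /= /eqP; rewrite nth_uniq ?enum_uniq // -cardE cardT ?enum_valP //.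
- by have := g_inr k' (enum_valP i); rewrite -e g_inl.
- by have := g_inr k (enum_valP i'); rewrite e g_inl.
by congr inr; apply: enum_val_inj.
Qed.

Let g_surj x : x \in codom g.
Proof.
have [/bigcupP[v vA /(g_inlP vA)[i [j [_ <-]]]]|nT] :=
  boolP (x \in \bigcup_(v in A) T v); first exact: codom_f.
rewrite -in_setC in nT.
by rewrite -(enum_rankK_in nT nT); exact: (codom_f g (inr _)).
Qed.

Let f x := iinv (g_surj x).

Let fK : cancel f g.
Proof. by move=> x; apply: f_iinv. Qed.

Let gK : cancel g f.
Proof. by move=> w; apply: g_inj; apply: fK. Qed.

Lemma card_disjoint_family : #|V| = #|A| * d.+1 + p.
Proof.
have <- : #|{: 'I_#|A| * 'I_d.+1 + 'I_p}| = #|V|.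
  by apply: bij_eq_card; exists f; [exact: gK | exact: fK].
by rewrite card_sum card_prod !card_ord.
Qed.

(** The bijection [g] carries blocks to the sets [T v], and on both sides a set is a simplex exactly
    when it contains no whole block. *)
Lemma isomorphic_join : 0 < d ->
  isomorphic K (join (join_power (skeleton (complete d.+1) d.-1) #|A|) (complete p)).
Proof.
move=> d0; exists f, g; split; [exact: fK | exact: gK | |] => [s|t].
  rewrite memK mem_join_skeleton // => /forall_inP noT.
  apply/'forall_existsP=> i.
  have /subsetPn[x xT xs] := noT _ (enum_valP i).
  have [i' [j [ei' ej]]] := g_inlP (enum_valP i) xT.
  exists j; rewrite -(enum_val_inj ei'); apply: contra xs => /imsetP[y ys ey].
  by rewrite -ej ey fK.
rewrite mem_join_skeleton // memK => /'forall_existsP tP.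
apply/forall_inP=> v vA; have [j jt] := tP (enum_rank_in vA v).
apply/subsetPn; exists (g (inl (enum_rank_in vA v, j))).
  by have := g_inl (enum_rank_in vA v) j; rewrite enum_rankK_in.
by rewrite mem_imset.
Qed.

End DisjointMissingFaces.

(** * From the spectral gap to the join decomposition *)

Theorem theorem1p4 (R : realType) (V : finType) (X : scomplex V)
    (d n : nat) (k : int)
    (d_ge1 : (1 <= d)%N) (cardV : #|V| = n) (hX : hdim X = d)
    (k_ge : -1 <= k)
    (gap : @is_spectral_gap V R X k
             ((d%:Z + 1) * (k + 1) - d%:Z * n%:Z)%:~R) :
  (exists s p : nat,
     [/\ s%:Z = n%:Z - k - 1,
         p%:Z = (d%:Z + 1) * (k + 1) - d%:Z * n%:Z &
         isomorphic X
           (join (join_power (skeleton (complete d.+1) d.-1) s)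
                 (complete p))])
  /\ cdim X = k.
Proof.
(* With [-1 <= k] the absolute value is k+1 itself, the number m of vertices of a k-simplex. *)
have km : (absz (k + 1))%:Z = k + 1 by rewrite gez0_abs // -lerBlDr.
move: gap; rewrite /is_spectral_gap /=; move: (absz _) km => m km [[f f_neq0] + _].
rewrite -km.
have -> : ((d%:Z + 1) * m%:Z - d%:Z * n%:Z)%:~R = (d.+1 * m)%:R - (d * #|V|)%:R :> R.
  by rewrite cardV [d%:Z + 1]addrC -intS -!PoszM rmorphB.
move=> eig; have [u fu] : exists u, f u != 0.
  apply/existsP; apply: contraR f_neq0 => /existsPn f0.
  apply/eqP/val_inj/ffunP => u; rewrite [RHS]ffunE; apply/eqP.
  by have := f0 u; rewrite negbK.
have [t _ tmax] := @arg_maxP _ _ _ u xpredT (fun u => `|f u|) isT.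
have fmax w : `|f w| <= `|f t| by apply: tmax.
have ft : f t != 0 by rewrite -normr_gt0 (lt_le_trans _ (fmax u)) ?normr_gt0.
have leXd : (hdim X <= d)%N by rewrite hX.
have [A [T [cardA TA disjT memX]]] := maximal_structure leXd eig fmax ft.
have memT v : v \in A -> v \in T v by case/TA.
have cardT v : v \in A -> #|T v| = d.+1 by case/TA.
have := card_disjoint_family cardT disjT; set p := #|~: _| => cardp.
have nE : n%:Z = #|A|%:Z + m%:Z by rewrite -cardV -cardA.
split.
  exists #|A|, p; split; last exact: isomorphic_join.
    by rewrite nE -addrA -opprD -km addrK.
  (* From n = (d+1)|A| + p and n = |A| + m one gets p = m - d|A| = (d+1)m - dn. *)
  move: cardp; rewrite cardV => /(congr1 Posz); rewrite PoszD PoszM -addn1 PoszD.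
  rewrite nE => /(canLR (addKr _)) <-.
  by ring.
rewrite /cdim (max_card_simplex memT disjT memX) -cardA addKn km.
by rewrite addrK.
Qed.
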